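(* For each positive integer $N$, let $T_N>0$ and let $\{H_N(\sigma):\sigma\in\{-1,1\}^N\}$ be $2^N$ independent, identically distributed, symmetric real random variables with common density $\phi_N$ whose support is the compact interval $[-T_N,T_N]$. For $0<s<1$ let $a_N(s)=\mathbf{P}\{H_N(\sigma)\ge sT_N\}$ (which does not depend on $\sigma$). For $\beta>0$ let $Z_N(\beta)=\sum_{\sigma\in\{-1,1\}^N}e^{-\beta H_N(\sigma)}$. Suppose that for every $s$ with $0<s<1$ there exists a real number $m\ge 0$ (possibly depending on $s$) such that the limit $\lim_{N\to\infty}N^m a_N(s)$ exists and satisfies $$0<\lim_{N\to\infty}N^m a_N(s)<\infty,$$ and suppose that $\lim_{N\to\infty}\frac{N}{T_N}=\alpha$ for some $\alpha$ with $0\le\alpha\le\infty$. Then for every $\beta>0$, $$\lim_{N\to\infty}\frac{1}{T_N}\mathbf{E}\log Z_N(\beta)=\alpha\log 2+\beta,$$ where, when $\alpha=\infty$, the right-hand side is interpreted as $+\infty$ (that is, the sequence on the left diverges to $+\infty$).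
   Context: This is the Random Energy Model of an $N$-particle system: $\sigma\in\{-1,1\}^N$ is a configuration, $H_N(\sigma)$ is its random Hamiltonian (energy), and $Z_N(\beta)$ is the partition function at parameter $\beta>0$. A real random variable $X$ is symmetric if $X$ and $-X$ have the same distribution. $\mathbf{P}$ and $\mathbf{E}$ denote probability and expectation, and $\log$ is the natural logarithm. No relation is assumed between the families $\{H_N(\sigma)\}$ for different values of $N$. *)

(* Defs.v *)
From HB Require Import structures.
From mathcomp Require Import all_boot all_order all_algebra.
From mathcomp Require Import all_classical all_reals all_analysis.

Set Implicit Arguments.
Unset Strict Implicit.
Unset Printing Implicit Defensive.

Import Order.TTheory GRing.Theory Num.Theory.
Import numFieldNormedType.Exports.

Local Open Scope classical_set_scope.
Local Open Scope ring_scope.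

Definition spin : finType := seq_sub ([:: -1; 1] : seq int).

Definition config (N : nat) : finType := {ffun 'I_N -> spin}.

(* Stated for plain functions, so that it applies to [\- X]; for a random
   variable [pushforward P X] is [distribution P X].  Only measurable sets
   matter: elsewhere the value of the pushforward says nothing about the law. *)
Definition identically_distributed d d' (T : measurableType d)
    (T' : measurableType d') (R : realType) (P : probability T R)
    (P' : probability T' R) (X : T -> R) (Y : T' -> R) : Prop :=
  forall A : set R, measurable A -> pushforward P X A = pushforward P' Y A.

Definition symmetric_RV d (T : measurableType d) (R : realType)
    (P : probability T R) (X : {RV P >-> R}) : Prop :=
  identically_distributed P P X (\- X).

Definition mutually_independent d (T : measurableType d) (R : realType)
    (P : probability T R) (I : finType) (X : I -> {RV P >-> R}) : Prop :=
  forall (J : {set I}) (A : I -> set R),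
    (forall i, measurable (A i)) ->
    P (\bigcap_(i in [set` J]) (X i @^-1` A i)) =
    (\prod_(i in J) P (X i @^-1` A i))%E.

Definition has_density d (T : measurableType d) (R : realType)
    (P : probability T R) (X : {RV P >-> R}) (phi : R -> R) : Prop :=
  [/\ measurable_fun [set: R] phi,
      forall x, 0 <= phi x &
      forall A : set R, measurable A ->
        distribution P X A = (\int[lebesgue_measure]_(x in A) (phi x)%:E)%E].

Definition closed_support (R : realType) (f : R -> R) : set R :=
  closure [set x | f x != 0].

Definition partition_function d (T : measurableType d) (R : realType)
    (P : probability T R) (N : nat) (H : config N -> {RV P >-> R}) (beta : R)
    (w : T) : R :=
  \sum_(sigma : config N) expR (- beta * H sigma w).

(* Main.v *)
Require Import Defs.
From mathcomp Require Import all_boot all_order all_algebra.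
From mathcomp Require Import all_classical all_reals all_analysis.
From mathcomp Require Import measurable_realfun ring lra.
Import Order.TTheory GRing.Theory Num.Theory.
Import numFieldNormedType.Exports.
Local Open Scope classical_set_scope.
Local Open Scope ring_scope.

(** Each term of the partition function is at most exp (beta T), because the
energies lie in [-T, T]; so ln Z <= N ln 2 + beta T almost surely, and likewise
ln Z >= N ln 2 - beta T.  Dividing by T gives the upper bound of the limit, and
the divergence when N / T tends to infinity.

When alpha is finite, the matching lower bound comes from the low energies.
Fix s < 1.  By symmetry each energy is at most -sT with probability a_N(s), so
the number C of such configurations has mean 2^N a_N(s); the energies being
pairwise independent, its variance is at most its mean.  If C is at least half
its mean, then

  ln Z >= N ln 2 + beta s T + ln (a_N(s) / 2),

and otherwise the crude bound ln Z >= N ln 2 - beta T holds.  Both cases are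
contained in a single pointwise inequality in which the loss is a multiple of
(C - E C)^2 (lemma [ln_sumexp_ge_count]), so that taking expectations
([expectation_lnZ_ge_tail]) costs only 8 beta T / (2^N a_N(s)).

Since N^m a_N(s) has a positive limit, ln a_N(s) = o(N), which is o(T) as alpha
is finite, and 2^N a_N(s) tends to infinity ([polynomial_decay_ln], [polynomial_decay_expn]):
after division by T both error terms vanish, and letting s tend to 1 gives
alpha ln 2 + beta ([scaled_cvg_fin]). *)

Set Implicit Arguments.
Unset Strict Implicit.

(** * Polynomially decaying sequences *)

(** With r the square root of n, ln n / n = 2 ln r / r^2 < 2 / r. *)
Lemma cvg_ln_natr_div (R : realType) : ln (n%:R : R) / n%:R @[n --> \oo] --> 0.
Proof.
apply/cvgrPdist_lt => e e0; near=> n.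
have n0 : (0 < n)%N by near: n; exists 1%N.
have n0R : 0 < n%:R :> R by rewrite ltr0n.
set r := Num.sqrt (n%:R : R).
have r0 : 0 < r by rewrite sqrtr_gt0.
have rn : r * r = n%:R by rewrite -expr2 sqr_sqrtr ?ltW.
have lnr : ln r < r by exact: ln_sublinear.
have lnn0 : 0 <= ln (n%:R : R) by apply: ln_ge0; rewrite ler1n.
have big : (2 / e) ^+ 2 < n%:R.
  by near: n; exact: nbhs_infty_gtr.
have bigr : 2 / e < r.
  by rewrite -(@ltr_pXn2r _ 2%N) ?nnegrE ?ltW ?divr_gt0 // [r ^+ 2]expr2 rn.
rewrite sub0r normrN ger0_norm ?divr_ge0 //.
rewrite ltr_pdivrMr // -rn lnM ?posrE //.
have : 2 < e * r by rewrite mulrC -ltr_pdivrMr.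
nra.
Unshelve. all: by end_near. Qed.

Lemma polynomial_decay_gt0 (R : realType) (m l : R) (a : nat -> R) :
  0 < l -> n%:R `^ m * a n @[n --> \oo] --> l -> \forall n \near \oo, 0 < a n.
Proof.
move=> l0 al; near=> n.
have : 0 < n%:R `^ m * a n by near: n; exact: cvgr_gt al _ l0.
by apply: contraTT; rewrite -!leNgt => an; rewrite mulr_ge0_le0 ?powR_ge0.
Unshelve. all: by end_near. Qed.

(** Taking logarithms, ln (a n) = - m ln n + O(1), and ln n = o(n). *)
Lemma polynomial_decay_ln (R : realType) (m l : R) (a : nat -> R) :
  0 < l -> n%:R `^ m * a n @[n --> \oo] --> l ->
  ln (a n) / n%:R @[n --> \oo] --> 0.
Proof.
move=> l0 al.
have lnal : ln (n%:R `^ m * a n) * n%:R^-1 @[n --> \oo] --> ln l * 0.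
  apply: cvgM; last first.
    apply/gtr0_cvgV0; last exact: cvgr_idn.
    by exists 1%N => // n /= n0; rewrite ltr0n.
  by apply: continuous_cvg => //; exact: continuous_ln.
have mln : m * (ln (n%:R : R) / n%:R) @[n --> \oo] --> m * 0.
  by apply: cvgMr; exact: cvg_ln_natr_div.
have lim0 : ln (n%:R `^ m * a n) * n%:R^-1 - m * (ln (n%:R : R) / n%:R)
    @[n --> \oo] --> 0.
  by have := cvgB lnal mln; rewrite !mulr0 subr0; apply.
apply: cvg_trans lim0; apply: near_eq_cvg.
near=> n.
have n0 : (0 < n)%N by near: n; exists 1%N.
have n0R : 0 < n%:R :> R by rewrite ltr0n.
have an : 0 < a n by near: n; exact: polynomial_decay_gt0 al.
rewrite /= lnM ?posrE ?powR_gt0 // ln_powR; ring.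
Unshelve. all: by end_near. Qed.

(** As ln (a n) = o(n), eventually ln (a n) > - n (ln 2) / 2, hence
2 ^ n * a n > exp (n (ln 2) / 2). *)
Lemma polynomial_decay_expn (R : realType) (m l : R) (a : nat -> R) :
  0 < l -> n%:R `^ m * a n @[n --> \oo] --> l ->
  ((2 ^ n)%:R * a n)^-1 @[n --> \oo] --> 0.
Proof.
move=> l0 al.
have ln2 : 0 < ln (2 : R) by apply: ln_gt0; lra.
have neg : - (ln 2 / 2) < 0 :> R by rewrite oppr_lt0 divr_gt0.
apply: (@squeeze_cvgr _ _ _ _ (cst 0) (fun n => geometric 1 (expR (- (ln 2 / 2))) n)).
- near=> n.
  have n0 : (0 < n)%N by near: n; exists 1%N.
  have n0R : 0 < n%:R :> R by rewrite ltr0n.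
  have an : 0 < a n by near: n; exact: polynomial_decay_gt0 al.
  have lna : - (ln 2 / 2) < ln (a n) / n%:R.
    by near: n; exact: cvgr_gt (polynomial_decay_ln l0 al) _ neg.
  apply/andP; split; first by rewrite invr_ge0 mulr_ge0 // ltW.
  rewrite /= mul1r -expRM_natl mulrN expRN.
  rewrite lef_pV2 ?posrE ?mulr_gt0 ?expR_gt0 ?ltr0n ?expn_gt0 //.
  rewrite -ler_ln ?posrE ?mulr_gt0 ?expR_gt0 ?ltr0n ?expn_gt0 // expRK.
  rewrite lnM ?posrE ?ltr0n ?expn_gt0 // natrX lnXn // -mulr_natl.
  move: lna; rewrite ltr_pdivlMr //; nra.
- exact: cvg_cst.
- apply: cvg_geometric; rewrite ger0_norm ?expR_ge0 // expR_lt1.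
Unshelve. all: by end_near. Qed.

(** * Counting pairwise independent events *)

Section Counting.
Context d (T : measurableType d) (R : realType) (P : probability T R).

Lemma bounded_Lfun1 (f : T -> R) (M : R) :
  measurable_fun [set: T] f -> (forall w, `|f w| <= M) -> f \in Lfun P 1.
Proof.
move=> mf fM; apply/Lfun1_integrable.
apply: measurable_bounded_integrable => //.
  by rewrite ltey_eq fin_num_measure.
exists M; split; first exact: num_real.
by move=> x Mx w _ /=; apply: (le_trans (fM w)); exact: ltW.
Qed.

(** The left-hand side is the covariance of the two indicators. *)
Lemma expectation_centered_indicM (A B : set T) (p : R) :
  measurable A -> measurable B -> P A = p%:E -> P B = p%:E ->
  ('E_P[fun w => ((\1_A w - p) * (\1_B w - p))%R] = P (A `&` B) - (p * p)%:E)%E.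
Proof.
move=> mA mB PA PB.
have L (C : set T) : measurable C -> (\1_C : T -> R) \in Lfun P 1.
  move=> mC; apply: (@bounded_Lfun1 _ 1); first exact: measurable_indic.
  by move=> w; rewrite indicE; case: (_ \in _); rewrite ?normr1 ?normr0.
have AB : (\1_A * \1_B : T -> R) = \1_(A `&` B) by rewrite indicI.
have := @covarianceE _ _ _ P (\1_A) (\1_B) (L _ mA) (L _ mB).
rewrite AB => /(_ (L _ (measurableI _ _ mA mB))).
rewrite !expectation_indic //; last exact: measurableI.
rewrite PA PB EFinM => <-.
by rewrite covariance.unlock !expectation_indic // PA PB.
Qed.

(** This is the variance of the count.  Pairwise independence cancels the
cross terms of the expanded square, and each of the diagonal terms is
p - p^2 <= p. *)
Lemma expectation_count_sqr (I : finType) (A : I -> set T) (p : R) :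
  (forall i, measurable (A i)) -> (forall i, P (A i) = p%:E) ->
  (forall i j, i != j -> P (A i `&` A j) = (P (A i) * P (A j))%E) ->
  ('E_P[fun w => ((\sum_i \1_(A i) w - #|I|%:R * p) ^+ 2)%R] <= (#|I|%:R * p)%:E)%E.
Proof.
move=> mA PA indA.
set g := fun (ij : I * I) w => (\1_(A ij.1) w - p) * (\1_(A ij.2) w - p) : R.
have -> : (fun w => (\sum_i \1_(A i) w - #|I|%:R * p) ^+ 2) =
    fun w => \sum_(ij : I * I) g ij w.
  apply/funext => w.
  rewrite -(pair_bigA _ (fun i j => g (i, j) w)) /= /g /=.
  have <- : \sum_i (\1_(A i) w - p) = \sum_i \1_(A i) w - #|I|%:R * p.
    by rewrite sumrB sumr_const mulr_natl.
  by rewrite expr2 mulr_suml; apply: eq_bigr => i _; rewrite mulr_sumr.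
have gL ij : g ij \in Lfun P 1.
  apply: (@bounded_Lfun1 _ ((1 + `|p|) * (1 + `|p|))).
    apply: measurable_funM; apply: measurable_realfun.measurable_funB => //;
      exact: measurable_indic.
  have b C w : `|\1_C w - p| <= 1 + `|p|.
    apply: (le_trans (ler_normB _ _)); rewrite lerD2r indicE.
    by case: (_ \in _); rewrite ?normr1 ?normr0.
  by move=> w; rewrite normrM ler_pM.
rewrite unlock.
under eq_integral do rewrite -sumEFin.
rewrite integral_sum //; last by move=> ij; apply/Lfun1_integrable; exact: gL.
rewrite -(pair_bigA _ (fun i j => \int[P]_w (g (i, j) w)%:E)%E) /=.
apply: (@le_trans _ _ (\sum_(i in I) p%:E)%E); last first.
  by rewrite sumEFin sumr_const mulr_natl.
apply: lee_sum => i _.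
have Eg j : (\int[P]_w (g (i, j) w)%:E)%E = (P (A i `&` A j) - (p * p)%:E)%E.
  by rewrite -(@expectation_centered_indicM (A i) (A j) p) // unlock.
rewrite (bigD1 i) //= big1 ?addr0 => [|j ji].
  rewrite Eg setIid PA lee_fin lerBlDr lerDl; nra.
by rewrite Eg indA 1?eq_sym // !PA subee.
Qed.

(** The logarithm of the partition function is bounded only almost surely;
this moves its expectation to a set where the bounds hold everywhere. *)
Lemma expectation_negligible (f : T -> R) (N : set T) :
  measurable_fun [set: T] f -> measurable N -> P N = 0%E ->
  ('E_P[f] = \int[P]_(w in ~` N) (f w)%:E)%E.
Proof.
move=> mf mN PN; rewrite unlock [RHS]integral_mkcond.
apply: ae_eq_integral => //.
- exact/measurable_EFinP.
- apply/measurable_restrict => //; first exact: measurableC.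
  by apply/measurable_EFinP; apply: measurable_funTS.
- exists N; split => // w /=; apply: contra_notP => Nw _.
  by rewrite patchE mem_set.
Qed.

End Counting.

(** * Bounds on the expected logarithm of the partition function *)

(** Here the sum C of truth values counts the indices of energy at most
- s t.  If C >= n p / 2, keeping only these indices already gives the first
three terms.  If C < n p / 2, then 4 (C - n p)^2 / (n p)^2 >= 1, so the
subtracted term is at least beta (1 + s) t, and the left-hand side falls
below the bound ln n - beta t, which always holds.  A quadratic loss makes the
expectation of the inequality computable from the variance of C alone. *)
Lemma ln_sumexp_ge_count (R : realType) (I : finType) (h : I -> R) (t beta s p : R) :
  (0 < #|I|)%N -> 0 < t -> 0 < beta -> 0 < s -> 0 < p <= 1 ->
  (forall i, `|h i| <= t) ->
  ln #|I|%:R + beta * s * t + ln (p / 2) -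
    beta * (1 + s) * t * (4 / (#|I|%:R * p) ^+ 2 *
      (\sum_i (h i <= - (s * t))%R%:R - #|I|%:R * p) ^+ 2)
  <= ln (\sum_i expR (- beta * h i)).
Proof.
move=> I0 t0 b0 s0 /andP[p0 p1] ht.
set n := #|I|%:R; set C := \sum_i (h i <= _)%R%:R.
have n0 : 0 < n by rewrite ltr0n.
have np0 : 0 < n * p by rewrite mulr_gt0.
set Z := \sum_i _.
have Zn : n * expR (- (beta * t)) <= Z.
  rewrite mulr_natl -sumr_const ler_sum // => i _.
  rewrite ler_expR mulNr lerN2 ler_pM2l //.
  by apply: le_trans (ht i); exact: ler_norm.
have ZC : C * expR (beta * s * t) <= Z.
  rewrite mulr_suml ler_sum // => i _.
  case: (leP (h i)) => [hi|_]; last by rewrite mulr0n mul0r expR_ge0.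
  rewrite mulr1n mul1r ler_expR mulNr -mulrN -mulrA ler_pM2l //; lra.
have Z0 : 0 < Z by apply: lt_le_trans Zn; rewrite mulr_gt0 ?expR_gt0.
set q := 4 / (n * p) ^+ 2 * (C - n * p) ^+ 2.
have q0 : 0 <= q by rewrite mulr_ge0 ?sqr_ge0 // divr_ge0 ?sqr_ge0.
have bt : 0 < beta * t by rewrite mulr_gt0.
have bst : 0 < beta * s * t by rewrite !mulr_gt0.
have b1st : 0 <= beta * (1 + s) * t.
  by rewrite ltW // !mulr_gt0 // addr_gt0.
have [Clarge|Csmall] := leP (n * p / 2) C.
- have : ln n + ln (p / 2) + beta * s * t <= ln Z.
    have p20 : 0 < p / 2 by rewrite divr_gt0.
    rewrite -lnM ?posrE // -[X in _ + X]expRK -lnM ?posrE ?mulr_gt0 ?expR_gt0 //.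
    rewrite ler_ln ?posrE ?mulr_gt0 ?expR_gt0 //; apply: le_trans ZC.
    by rewrite ler_pM2r ?expR_gt0 // mulrA.
  have : 0 <= beta * (1 + s) * t * q by rewrite mulr_ge0.
  lra.
- have : ln n - beta * t <= ln Z.
    rewrite -[X in _ + X]expRK -lnM ?posrE ?expR_gt0 //.
    by rewrite ler_ln ?posrE ?mulr_gt0 ?expR_gt0.
  have lnp : ln (p / 2) <= 0 by apply: ln_le0; lra.
  have q1 : 1 <= q.
    rewrite /q mulrAC ler_pdivlMr ?exprn_gt0 // mul1r.
    nra.
  have : beta * (1 + s) * t * 1 <= beta * (1 + s) * t * q.
    by rewrite ler_wpM2l.
  lra.
Qed.

Section LogPartition.
Context d (T : measurableType d) (R : realType) (P : probability T R).
Context (I : finType) (H : I -> {RV P >-> R}) (t beta : R).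
Hypotheses (I0 : (0 < #|I|)%N) (beta0 : 0 < beta).
Hypothesis Hbounded : forall i, {ae P, forall w, `|H i w| <= t}.

Local Notation n := (#|I|%:R : R).
Local Notation Z := (fun w => \sum_(i : I) expR (- beta * H i w)).

Let n0 : 0 < n. Proof. by rewrite ltr0n. Qed.

Let bounded_off : exists N, [/\ measurable N, P N = 0%E &
  forall w, ~ N w -> forall i, `|H i w| <= t].
Proof.
have /= [N [mN PN sN]] : {ae P, forall w, forall i, `|H i w| <= t}.
  exact: filter_forall.
by exists N; split => // w; apply: contra_notP => Hw; apply: sN.
Qed.

Let measurable_lnZ : measurable_fun [set: T] (fun w => ln (Z w)).
Proof.
apply: measurableT_comp => //; apply: measurable_sum => i.
by apply: measurableT_comp => //; exact: measurable_funM.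
Qed.

Let lnZ_bounds w : (forall i, `|H i w| <= t) ->
  ln n - beta * t <= ln (Z w) <= ln n + beta * t.
Proof.
move=> Hw.
have lb i : expR (- (beta * t)) <= expR (- beta * H i w) <= expR (beta * t).
  have := Hw i; rewrite !ler_expR ler_norml => /andP[Hl Hu].
  by rewrite mulNr lerN2 lerNl -mulrN !ler_pM2l // Hu Hl.
have c (y : R) : n * y = \sum_(i : I) y by rewrite sumr_const mulr_natl.
have low : n * expR (- (beta * t)) <= Z w.
  by rewrite c ler_sum // => i _; case/andP: (lb i).
have Z0 : 0 < Z w by apply: lt_le_trans low; rewrite mulr_gt0 ?expR_gt0.
apply/andP; split.
- rewrite -[X in _ + X]expRK -lnM ?posrE ?expR_gt0 // ler_ln // posrE.
  by rewrite mulr_gt0 ?expR_gt0.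
- rewrite -[X in _ <= _ + X]expRK -lnM ?posrE ?expR_gt0 // ler_ln ?posrE //.
    by rewrite c ler_sum // => i _; case/andP: (lb i).
  by rewrite mulr_gt0 ?expR_gt0.
Qed.

Let integral_off_cst (N : set T) (c : R) : measurable N -> P N = 0%E ->
  (\int[P]_(w in ~` N) c%:E)%E = c%:E.
Proof.
move=> mN PN; rewrite integral_cst; last exact: measurableC.
by rewrite [X in (_ * X)%E](probability_setC P mN) PN sube0 mule1.
Qed.

Let integrable_lnZ (N : set T) : measurable N ->
  (forall w, ~ N w -> forall i, `|H i w| <= t) ->
  P.-integrable (~` N) (fun w => (ln (Z w))%:E).
Proof.
move=> mN HN; apply: measurable_bounded_integrable.
- exact: measurableC.
- by rewrite ltey_eq fin_num_measure //; exact: measurableC.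
- exact: measurable_funTS.
- exists (`|ln n| + beta * t); split; first exact: num_real.
  move=> M ltM w Nw /=; apply: le_trans (ltW ltM).
  have := lnZ_bounds (HN w Nw).
  have := ler_norm (ln n); have := ler_norm (- ln n); rewrite normrN ler_norml.
  lra.
Qed.

Let integrable_off_cst (N : set T) (c : R) : measurable N ->
  P.-integrable (~` N) (fun w => c%:E).
Proof.
move=> mN; apply: finite_measure_integrable_cst; exact: measurableC.
Qed.

Lemma expectation_lnZ_le :
  ('E_P[fun w => ln (Z w)] <= (ln n + beta * t)%:E)%E.
Proof.
have [N [mN PN HN]] := bounded_off.
rewrite (expectation_negligible measurable_lnZ mN PN).
rewrite -(integral_off_cst (ln n + beta * t) mN PN).
apply: le_integral => //; [exact: measurableC|exact: integrable_lnZ| |].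
  exact: integrable_off_cst.
by move=> w /set_mem /HN /lnZ_bounds /andP[_]; rewrite lee_fin.
Qed.

Lemma expectation_lnZ_ge :
  ((ln n - beta * t)%:E <= 'E_P[fun w => ln (Z w)])%E.
Proof.
have [N [mN PN HN]] := bounded_off.
rewrite (expectation_negligible measurable_lnZ mN PN).
rewrite -(integral_off_cst (ln n - beta * t) mN PN).
apply: le_integral => //; [exact: measurableC| |exact: integrable_lnZ|].
  exact: integrable_off_cst.
by move=> w /set_mem /HN /lnZ_bounds /andP[+ _]; rewrite lee_fin.
Qed.

(** Integrates [ln_sumexp_ge_count], the square contributing at most n p. *)
Lemma expectation_lnZ_ge_tail (s p : R) : 0 < t -> 0 < s -> 0 < p <= 1 ->
  (forall i, P [set w | H i w <= - (s * t)] = p%:E) ->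
  (forall i j, i != j ->
    P ([set w | H i w <= - (s * t)] `&` [set w | H j w <= - (s * t)]) =
    (p%:E * p%:E)%E) ->
  ((ln n + beta * s * t + ln (p / 2) - beta * (1 + s) * t * (4 / (n * p)))%:E
    <= 'E_P[fun w => ln (Z w)])%E.
Proof.
move=> t0 s0 p01 Pp indp; have /andP[p0 p1] := p01.
set A := fun i => [set w | H i w <= - (s * t)].
have mA i : measurable (A i).
  rewrite (_ : A i = H i @^-1` `]-oo, - (s * t)]); last first.
    by apply/seteqP; split => w /=; rewrite in_itv.
  exact: measurable_funPTI.
set Q := fun w => (\sum_i \1_(A i) w - n * p) ^+ 2 : R.
have EQ : ('E_P[Q] <= (n * p)%:E)%E.
  by apply: expectation_count_sqr => // i j ij; rewrite indp // !Pp.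
have mQ : measurable_fun [set: T] Q.
  apply: measurable_funX; apply: measurable_funB => //.
  by apply: measurable_sum => i; exact: measurable_indic.
set c0 := ln n + beta * s * t + ln (p / 2).
set k := beta * (1 + s) * t * (4 / (n * p) ^+ 2).
have np0 : 0 < n * p by rewrite mulr_gt0.
have k0 : 0 <= k by rewrite ltW // !mulr_gt0 ?invr_gt0 ?exprn_gt0 ?addr_gt0.
have [N [mN PN HN]] := bounded_off.
rewrite (expectation_negligible measurable_lnZ mN PN).
have QL : P.-integrable [set: T] (EFin \o Q).
  apply/integrableP; split; first exact/measurable_EFinP.
  apply: le_lt_trans (ltry (n * p)); apply: le_trans EQ; rewrite unlock.
  by under eq_integral do rewrite /= ger0_norm ?sqr_ge0 //.
have QN : P.-integrable (~` N) (EFin \o Q).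
  exact: (integrableS measurableT (measurableC mN) (@subsetT _ _) QL).
have kQN : P.-integrable (~` N) (fun w => k%:E * (Q w)%:E)%E.
  by apply: integrableZl => //; exact: measurableC.
apply: (@le_trans _ _ (\int[P]_(w in ~` N) (c0%:E - k%:E * (Q w)%:E))%E).
  rewrite integralB //; [|exact: measurableC|exact: integrable_off_cst].
  rewrite integral_off_cst // integralZl //; last exact: measurableC.
  have : (\int[P]_(w in ~` N) (Q w)%:E <= (n * p)%:E)%E.
    by rewrite -(expectation_negligible mQ mN PN).
  have : (0 <= \int[P]_(w in ~` N) (Q w)%:E)%E.
    by apply: integral_ge0 => w _; rewrite lee_fin sqr_ge0.
  case: (\int[P]_(w in ~` N) (Q w)%:E)%E => [q| |] //.
  rewrite !lee_fin => q0 qnp; rewrite lerB // /k.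
  have -> : beta * (1 + s) * t * (4 / (n * p)) =
     beta * (1 + s) * t * (4 / (n * p) ^+ 2) * (n * p).
    by field; rewrite !gt_eqF.
  by rewrite ler_wpM2l.
apply: le_integral => //.
- exact: measurableC.
- by apply: integrableB => //; [exact: measurableC|exact: integrable_off_cst].
- exact: integrable_lnZ.
move=> w /set_mem /HN Hw; rewrite -EFinM -EFinB lee_fin /k /Q /c0.
have := ln_sumexp_ge_count I0 t0 beta0 s0 p01 Hw.
rewrite -[_ * (4 / _) * _ ^+ 2]mulrA.
suff -> : \sum_i \1_(A i) w = \sum_i (H i w <= - (s * t))%R%:R :> R by [].
apply: eq_bigr => i _; rewrite indicE; congr (_%:R); congr nat_of_bool.
by apply/idP/idP => [/set_mem|/mem_set].
Qed.
End LogPartition.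

(** * Consequences of the assumptions on the energies *)

Lemma density_ae_support d (T : measurableType d) (R : realType)
    (P : probability T R) (X : {RV P >-> R}) (phi : R -> R) (K : set R) :
  has_density X phi -> measurable K -> closed_support phi `<=` K ->
  {ae P, forall w, K (X w)}.
Proof.
move=> [_ _ Xphi] mK phiK; exists (X @^-1` (~` K)); split => //.
- exact: measurable_funPTI (measurableC mK).
- rewrite -[LHS]/(distribution P X (~` K)) Xphi; last exact: measurableC.
  rewrite -[RHS](integral0 lebesgue_measure (~` K)).
  apply: eq_integral => x /set_mem xK; apply/eqP; rewrite eqe.
  by apply: contra_notT xK => phix; apply: phiK; exact: subset_closure.
Qed.

Lemma symmetric_lower_tail d (T : measurableType d) (R : realType)
    (P : probability T R) (X : {RV P >-> R}) (c : R) :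
  symmetric_RV X -> P [set w | X w <= - c] = P [set w | c <= X w].
Proof.
move=> /(_ `[c, +oo[%classic (measurable_itv _)); rewrite /pushforward.
have -> : X @^-1` `[c, +oo[ = [set w | c <= X w].
  by apply/seteqP; split => w /=; rewrite in_itv /= andbT.
have -> : (\- X) @^-1` `[c, +oo[ = [set w | X w <= - c].
  by apply/seteqP; split => w /=; rewrite in_itv /= andbT lerNr.
by [].
Qed.

Lemma mutually_independent_pair d (T : measurableType d) (R : realType)
    (P : probability T R) (I : finType) (X : I -> {RV P >-> R}) (B : set R)
    (i j : I) : mutually_independent X -> measurable B -> i != j ->
  P ((X i @^-1` B) `&` (X j @^-1` B)) = (P (X i @^-1` B) * P (X j @^-1` B))%E.
Proof.
move=> indX mB ij; have := indX [set i; j]%SET (fun=> B) (fun=> mB).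
rewrite big_setU1 ?inE //= big_set1 => <-; congr (P _).
apply/seteqP; split => w.
  by move=> [wi wj] k; rewrite /= !inE => /orP[] /eqP ->.
by move=> wJ; split; apply: wJ; rewrite /= !inE eqxx ?orbT.
Qed.

Lemma card_config N : #|config N| = (2 ^ N)%N.
Proof. by rewrite card_ffun card_ord card_seq_sub. Qed.

(** * Passing to the limit *)

Section ScaledLimit.
Variables (R : realType) (T u : nat -> R) (a : nat -> R -> R) (beta : R).
Hypothesis beta0 : 0 < beta.
Hypothesis T0 : forall N, (0 < N)%N -> 0 < T N.
Hypothesis u_le : forall N, (0 < N)%N ->
  u N <= ln (2 ^ N)%:R + beta * T N.
Hypothesis u_ge : forall N, (0 < N)%N ->
  ln (2 ^ N)%:R - beta * T N <= u N.
Hypothesis u_ge_tail : forall N s, (0 < N)%N -> 0 < s < 1 -> 0 < a N s ->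
  ln (2 ^ N)%:R + beta * s * T N + ln (a N s / 2) -
    beta * (1 + s) * T N * (4 / ((2 ^ N)%:R * a N s)) <= u N.
Hypothesis a_lim : forall s : R, 0 < s < 1 ->
  exists m : R, 0 <= m /\
  exists l : R, 0 < l /\ (N%:R `^ m * a N s) @[N --> \oo] --> l.

Let ln2 : 0 < ln (2 : R).
Proof. by apply: ln_gt0; lra. Qed.

Let ln_expn2 N : ln (2 ^ N)%:R = N%:R * ln 2 :> R.
Proof. by rewrite natrX lnXn // mulr_natl. Qed.

Lemma scaled_cvg_pinfty : N%:R / T N @[N --> \oo] --> +oo ->
  (T N)^-1 * u N @[N --> \oo] --> +oo.
Proof.
move=> NT; apply/cvgryPge => M; near=> N.
have N0 : (0 < N)%N by near: N; exists 1%N.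
have xN : (M + beta) / ln 2 <= N%:R / T N.
  by near: N; move/cvgryPge : NT => /(_ ((M + beta) / ln 2)).
have TN := T0 N0; rewrite mulrC ler_pdivlMr //.
apply: le_trans (u_ge N0); rewrite ln_expn2.
move: xN; rewrite ler_pdivrMr // mulrAC ler_pdivlMr //; lra.
Unshelve. all: by end_near. Qed.

(** The tail bound squeezes the limit inferior above alpha ln 2 + beta s for
every s < 1; it suffices to use one s with beta (1 - s) <= e / 2. *)
Lemma scaled_cvg_fin (alpha : R) : N%:R / T N @[N --> \oo] --> alpha ->
  (T N)^-1 * u N @[N --> \oo] --> alpha * ln 2 + beta.
Proof.
move=> NT; apply/cvgrPdist_lt => e e0.
pose s := 1 - e / (2 * (beta + e)).
have be0 : 0 < 2 * (beta + e) by rewrite mulr_gt0 // addr_gt0.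
have s01 : 0 < s < 1.
  rewrite /s subr_gt0 gtrBl ltr_pdivrMr // divr_gt0 // andbT.
  by have := beta0; lra.
have bs : beta - e / 2 <= beta * s.
  rewrite /s mulrBr mulr1 lerD2l lerN2 mulrA ler_pdivrMr //.
  have -> : e / 2 * (2 * (beta + e)) = beta * e + e ^+ 2 by field.
  by rewrite lerDl sqr_ge0.
have [m [_ [l [l0 al]]]] := a_lim s01.
pose x N : R := N%:R / T N.
have lnak : ln (a N s / 2) / N%:R @[N --> \oo] --> 0.
  apply: (@polynomial_decay_ln _ m (l / 2)); first by rewrite divr_gt0.
  under eq_fun do rewrite mulrA.
  exact: cvgMl.
have ek := polynomial_decay_expn l0 al.
(* the lower bound [u_ge_tail] divided by T N *)
pose v N := x N * ln 2 + beta * s + x N * (ln (a N s / 2) / N%:R) -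
  beta * (1 + s) * 4 * ((2 ^ N)%:R * a N s)^-1.
have vlim : v N @[N --> \oo] --> alpha * ln 2 + beta * s.
  have -> : alpha * ln 2 + beta * s = alpha * ln 2 + beta * s + alpha * 0 -
    beta * (1 + s) * 4 * 0 by ring.
  apply: cvgB; last exact: cvgMr.
  apply: cvgD; last exact: cvgM.
  by apply: cvgD; [exact: cvgMl|exact: cvg_cst].
have wlim : x N * ln 2 + beta @[N --> \oo] --> alpha * ln 2 + beta.
  by apply: cvgD; [exact: cvgMl|exact: cvg_cst].
have lowlt : alpha * ln 2 + beta - e < alpha * ln 2 + beta * s by lra.
have uplt : alpha * ln 2 + beta < alpha * ln 2 + beta + e by lra.
near=> N.
have N0 : (0 < N)%N by near: N; exists 1%N.
have N0R : 0 < N%:R :> R by rewrite ltr0n.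
have TN := T0 N0.
have aN : 0 < a N s by near: N; exact: polynomial_decay_gt0 l0 al.
have vN : alpha * ln 2 + beta - e < v N.
  by near: N; exact: cvgr_gt vlim _ lowlt.
have wN : x N * ln 2 + beta < alpha * ln 2 + beta + e.
  by near: N; exact: cvgr_lt wlim _ uplt.
have uw : (T N)^-1 * u N <= x N * ln 2 + beta.
  rewrite mulrC ler_pdivrMr //; apply: le_trans (u_le N0) _.
  rewrite ln_expn2 mulrDl lerD2r /x le_eqVlt; apply/orP; left; apply/eqP.
  by field; rewrite gt_eqF.
have vu : v N <= (T N)^-1 * u N.
  rewrite mulrC ler_pdivlMr //; apply: le_trans (u_ge_tail N0 s01 aN).
  rewrite ln_expn2 le_eqVlt; apply/orP; left; apply/eqP; rewrite /v /x.
  have : (2 ^ N)%:R * a N s != 0.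
    by rewrite mulf_neq0 ?gt_eqF // ltr0n expn_gt0.
  move: (_ * a N s) => y y0.
  by field; rewrite y0 !gt_eqF.
rewrite ltr_distlC; apply/andP; split; lra.
Unshelve. all: by end_near. Qed.

End ScaledLimit.

(** * The limit of the scaled expectation *)

Unset Implicit Arguments.

Theorem theorem2p1 (R : realType)
    (d : nat -> measure_display)
    (Omega : forall N : nat, measurableType (d N))
    (P : forall N : nat, probability (Omega N) R)
    (T : nat -> R)
    (phi : nat -> R -> R)
    (H : forall N : nat, config N -> {RV (P N) >-> R})
    (a : nat -> R -> R)
    (alpha : \bar R)
    (T_gt0 : forall N, (0 < N)%N -> 0 < T N)
    (H_indep : forall N, (0 < N)%N -> mutually_independent (H N))
    (H_ident : forall N, (0 < N)%N -> forall sigma tau : config N,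
      identically_distributed (P N) (P N) (H N sigma) (H N tau))
    (H_sym : forall N, (0 < N)%N -> forall sigma : config N,
      symmetric_RV (H N sigma))
    (H_density : forall N, (0 < N)%N -> forall sigma : config N,
      has_density (H N sigma) (phi N))
    (phi_support : forall N, (0 < N)%N ->
      closed_support (phi N) = `[- T N, T N]%classic)
    (a_def : forall N, (0 < N)%N -> forall s : R, 0 < s < 1 ->
      forall sigma : config N,
      P N [set w | s * T N <= H N sigma w] = (a N s)%:E)
    (a_lim : forall s : R, 0 < s < 1 ->
      exists m : R, 0 <= m /\
      exists l : R, 0 < l /\ (N%:R `^ m * a N s) @[N --> \oo] --> l)
    (alpha_ge0 : (0 <= alpha)%E)
    (alpha_lim : (N%:R / T N)%:E @[N --> \oo] --> alpha) :
  forall beta : R, 0 < beta ->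
    ((T N)^-1%:E *
       'E_(P N)[fun w => ln (partition_function (H N) beta w)])%E
      @[N --> \oo] --> (alpha * (ln 2)%:E + beta%:E)%E.
Proof.
move=> beta beta0.
pose E N := ('E_(P N)[fun w => ln (partition_function (H N) beta w)])%E.
have card_gt0 N : (0 < #|config N|)%N by rewrite card_config expn_gt0.
have bounded N : (0 < N)%N -> forall sigma,
    {ae P N, forall w, `|H N sigma w| <= T N}.
  move=> N0 sigma.
  have := density_ae_support (H_density N N0 sigma)
    (measurable_itv `[- T N, T N]).
  rewrite (phi_support N N0) => /(_ (@subset_refl _ _)).
  by apply: filterS => w /=; rewrite in_itv /= ler_norml.
have E_le N : (0 < N)%N -> (E N <= (ln (2 ^ N)%:R + beta * T N)%:E)%E.
  move=> N0; rewrite -card_config.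
  exact: (expectation_lnZ_le (card_gt0 N) beta0 (bounded N N0)).
have E_ge N : (0 < N)%N -> ((ln (2 ^ N)%:R - beta * T N)%:E <= E N)%E.
  move=> N0; rewrite -card_config.
  exact: (expectation_lnZ_ge (card_gt0 N) beta0 (bounded N N0)).
have E_fin N : (0 < N)%N -> E N = (fine (E N))%:E.
  move=> N0; rewrite fineK // fin_numE.
  have := E_le N N0; have := E_ge N N0; by case: (E N).
have E_ge_tail N s : (0 < N)%N -> 0 < s < 1 -> 0 < a N s ->
  ((ln (2 ^ N)%:R + beta * s * T N + ln (a N s / 2) -
    beta * (1 + s) * T N * (4 / ((2 ^ N)%:R * a N s)))%:E <= E N)%E.
  move=> N0 s01 aN0; rewrite -card_config.
  have tail sigma : P N [set w | H N sigma w <= - (s * T N)] = (a N s)%:E.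
    by rewrite (symmetric_lower_tail _ (H_sym N N0 sigma)) a_def.
  have preE sigma : [set w | H N sigma w <= - (s * T N)] =
      H N sigma @^-1` `]-oo, - (s * T N)].
    by apply/seteqP; split => w /=; rewrite in_itv.
  (* the configuration only serves to read a N s as a probability *)
  have aN1 : a N s <= 1.
    rewrite -lee_fin -(tail [ffun=> SeqSub (mem_head _ _)]) preE.
    by apply: probability_le1; exact: measurable_funPTI.
  apply: (expectation_lnZ_ge_tail (card_gt0 N) beta0 (bounded N N0)).
  - exact: T_gt0.
  - by case/andP: s01.
  - by rewrite aN0.
  - exact: tail.
  - move=> sigma tau st; rewrite -{1}(tail sigma) -(tail tau) !preE.
    exact: mutually_independent_pair (H_indep N N0) _ st.
pose u N := fine (E N).
have u_le N : (0 < N)%N -> u N <= ln (2 ^ N)%:R + beta * T N.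
  by move=> N0; rewrite -lee_fin -E_fin //; exact: E_le.
have u_ge N : (0 < N)%N -> ln (2 ^ N)%:R - beta * T N <= u N.
  by move=> N0; rewrite -lee_fin -E_fin //; exact: E_ge.
have u_ge_tail N s : (0 < N)%N -> 0 < s < 1 -> 0 < a N s ->
  ln (2 ^ N)%:R + beta * s * T N + ln (a N s / 2) -
    beta * (1 + s) * T N * (4 / ((2 ^ N)%:R * a N s)) <= u N.
  by move=> N0 s01 aN0; rewrite -lee_fin -E_fin //; exact: E_ge_tail.
suff : ((T N)^-1 * u N)%:E @[N --> \oo] --> (alpha * (ln 2)%:E + beta%:E)%E.
  apply: cvg_trans; apply: near_eq_cvg; near=> N.
  have N0 : (0 < N)%N by near: N; exists 1%N.
  by rewrite EFinM -E_fin.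
case: alpha alpha_ge0 alpha_lim => [r| |] // _.
- move=> /fine_cvgP[_ NT].
  rewrite -EFinM -EFinD; apply: cvg_EFin; first by near=> N.
  exact: (scaled_cvg_fin beta0 T_gt0 u_le u_ge_tail a_lim).
- move=> /cvgeryP NT.
  rewrite gt0_mulye ?lte_fin ?ln_gt0 //; last by rewrite ltrDl.
  rewrite addye //; apply/cvgeryP.
  exact: (scaled_cvg_pinfty T_gt0 u_ge).
Unshelve. all: by end_near. Qed.
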